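(* Let $(M,F)$ be a connected non-Riemannian generalized Berwald manifold of dimension three with compatible Riemannian metric $\gamma$, let $p\in M$, choose local coordinates with $\partial/\partial u^1,\partial/\partial u^2,\partial/\partial u^3$ orthonormal at $p$ with respect to $\gamma$, and assume we are in the undetermined case: the space $\{\vec t\in T_pM : \langle C_w\times G_w,\vec t\,\rangle=0 \text{ for all } w\in T_pM\setminus\{0\}\}$ is one-dimensional. Let $v\in T_pM$ be a not vertical contact element, let $D=(D_1,D_2,D_3)$, $(P_1,P_2,P_3)$, $(Q_1,Q_2,Q_3)$, $(R_1,R_2,R_3)$ be the vectors associated with $v$ as defined in the context, so that the torsions at $p$ solving the compatibility equations are exactly those with components $$T_{13}^1=-P_2-sD_2,\quad T_{23}^2=Q_1+tD_1,\quad T_{23}^3=R_1+uD_1,$$ $$T_{12}^1=P_3+sD_3,\quad T_{12}^2=Q_3+tD_3,\quad T_{13}^3=-R_2-uD_2,$$ $$T_{12}^3=-P_1-Q_2-sD_1-tD_2,\quad T_{13}^2=P_1+R_3+sD_1+uD_3,\quad T_{23}^1=-Q_2-R_3-tD_2-uD_3,$$ with $s,t,u\in\mathbb{R}$. Put $$d = 4D_1P_1+2D_1Q_2+2D_1R_3+2D_2P_2+2D_3P_3,$$ $$e=2D_1Q_1+2D_2P_1+4D_2Q_2+2D_2R_3+2D_3Q_3,$$ $$f=2D_1R_1+2D_2R_2+2D_3P_1+2D_3Q_2+4D_3R_3,$$ $$g=2D_1D_2,\quad h=2D_1D_3,\quad i=2D_2D_3,$$ $$k = D_1^2+2D_2^2+2D_3^2,\quad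 l=2D_1^2+D_2^2+2D_3^2,\quad m=2D_1^2+2D_2^2+D_3^2,\quad \|D\|^2=D_1^2+D_2^2+D_3^2.$$ Then the torsion components at $p$ of the extremal compatible linear connection belong to the parameters $$s^0 = \frac{-2dk+eg+fh}{8 \|D\|^4},\quad t^0 = \frac{dg-2el+fi}{8 \|D\|^4},\quad u^0 = \frac{dh+ei-2fm}{8 \|D\|^4},$$ that is, they are $$T_{13}^1=-P_2-s^0D_2,\quad T_{23}^2=Q_1+t^0D_1,\quad T_{23}^3=R_1+u^0D_1,$$ $$T_{12}^1=P_3+s^0D_3,\quad T_{12}^2=Q_3+t^0D_3,\quad T_{13}^3=-R_2-u^0D_2,$$ $$T_{12}^3=-P_1-Q_2-s^0D_1-t^0D_2,\quad T_{13}^2=P_1+R_3+s^0D_1+u^0D_3,\quad T_{23}^1=-Q_2-R_3-t^0D_2-u^0D_3.$$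
   Context: A Finsler function on a smooth manifold $M$ is a continuous $F\colon TM\to\mathbb{R}$, smooth off the zero section, with $F(tv)=tF(v)$ for $t>0$, such that the fibrewise Hessian of $F^2/2$ is positive definite at all nonzero $v$. A linear connection is compatible to $F$ if its parallel transports preserve $F$; a generalized Berwald manifold is a Finsler manifold admitting a compatible linear connection. A Riemannian metric $\gamma$ is compatible to $F$ if every linear connection compatible to $F$ is metrical with respect to $\gamma$; $\Gamma^{*k}_{ij}$ are its Christoffel symbols. With induced coordinates $x^i=u^i\circ\pi$, $y^i(v)=v(u^i)$ on $TM$, put $X_i^{h^*}=\frac{\partial}{\partial x^i}-y^j\,\Gamma^{*k}_{ij}\circ\pi\,\frac{\partial}{\partial y^k}$. $T_pM$ is identified with Euclidean $\mathbb{R}^3$ by the orthonormal coordinate basis, $\langle\cdot,\cdot\rangle=\gamma_p$, $\times$ is the usual cross product; $C\sim(y^1,y^2,y^3)$ and $G=\mathrm{grad}\,F\sim(\partial F/\partial y^1,\partial F/\partial y^2,\partial F/\partial y^3)$ are vector fields on $T_pM\setminus\{0\}$. A nonzero $v\in T_pM$ is vertical contact if $C_v$ and $G_v$ are parallel, i.e. $C_v\times G_v=0$. Compatibility equations at $p$: the linear system $y^j(v)\left(T^{l}_{jk}\gamma^{kr}\gamma_{il}+T^{l}_{ik}\gamma^{kr}\gamma_{jl}-T_{ij}^r\right)(p)\frac{\partial F}{\partial y^r}(v)=-2X_i^{h^*}F(v)$, $i=1,2,3$, $v\in T_pM\setminus\{0\}$, for $T\in\wedge^2T_p^*M\otimes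 T_pM$ with components $T_{ab}^c=-T_{ba}^c$. It is equivalent to compatibility of the metrical connection with torsion $T$, i.e. with connection parameters $\Gamma_{ij}^r=\Gamma_{ij}^{*r}-\frac12(T^{l}_{jk}\gamma^{kr}\gamma_{il}+T^{l}_{ik}\gamma^{kr}\gamma_{jl}-T_{ij}^r)$. Let $c_0$ be the integral curve of the normalized vector field $(C\times G)/|C\times G|$ with $c_0(0)=v$, let $(\vec T,\vec N,\vec B)$ be its Frenet–Serret frame and $\kappa$ its curvature, and let $b_i^0=-2X_i^{h^*}F/|C\times G|$ (defined on the not vertical contact elements). Define $D=\vec B(0)$ and $$P=\tfrac12\Big(b_1^0(v)\vec T(0)+\tfrac{(b_1^0\circ c_0)'(0)}{\kappa(0)}\vec N(0)\Big),\quad Q=\tfrac12\Big(b_2^0(v)\vec T(0)+\tfrac{(b_2^0\circ c_0)'(0)}{\kappa(0)}\vec N(0)\Big),\quad R=\tfrac12\Big(b_3^0(v)\vec T(0)+\tfrac{(b_3^0\circ c_0)'(0)}{\kappa(0)}\vec N(0)\Big).$$ The extremal compatible linear connection is the uniquely determined compatible linear connection whose torsion minimizes, at each point, the norm coming from the inner product $\langle T_p,S_p\rangle=\sum_{i<j,k}T_{ij}^k(p)S_{ij}^k(p)$ on $\wedge^2T_p^*M\otimes T_pM$ (components with respect to a coordinate basis orthonormal at $p$), i.e. minimizes $\|T_p\|^2=\sum_{i<j,k}(T_{ij}^k(p))^2$ among all solutions of the compatibility equations at $p$. *)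

(* Defs.v *)
From HB Require Import structures.
From mathcomp Require Import all_boot all_order all_algebra.
From mathcomp Require Import all_classical all_reals all_analysis.

Set Implicit Arguments.
Unset Strict Implicit.
Unset Printing Implicit Defensive.
Import Order.TTheory GRing.Theory Num.Theory.
Import numFieldNormedType.Exports.
Local Open Scope classical_set_scope.
Local Open Scope ring_scope.

(* [A] is meant to be open and [V] finite dimensional.  Smoothness means that
   all iterated directional derivatives exist, are differentiable on [A] and
   are continuous there. *)
Fixpoint Ck_on (R : realType) (V W : normedModType R) (k : nat)
    (A : set V) (f : V -> W) : Prop :=
  if k is k'.+1 then
    (forall x, A x -> differentiable f x) /\
    (forall v : V, Ck_on k' A ('D_v f))
  else forall x, A x -> {for x, continuous f}.

Definition smooth_on (R : realType) (V W : normedModType R)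
    (A : set V) (f : V -> W) : Prop := forall k, Ck_on k A f.

Definition basis_vec (R : realType) (n : nat) (i : 'I_n) : 'rV[R]_n :=
  delta_mx 0 i.

(* d/du^i on a coordinate neighbourhood U; d/dx^i and d/dy^i on the induced
   neighbourhood U x R^n of the tangent bundle, with points z = (x, y). *)
Definition dpart (R : realType) (n : nat) (W : normedModType R) (i : 'I_n)
    (f : 'rV[R]_n -> W) : 'rV[R]_n -> W := 'D_(basis_vec R i) f.

Definition dbase (R : realType) (n : nat) (i : 'I_n)
    (f : 'rV[R]_n * 'rV[R]_n -> R) : 'rV[R]_n * 'rV[R]_n -> R :=
  'D_((basis_vec R i, 0) : 'rV[R]_n * 'rV[R]_n) f.

Definition dfib (R : realType) (n : nat) (i : 'I_n)
    (f : 'rV[R]_n * 'rV[R]_n -> R) : 'rV[R]_n * 'rV[R]_n -> R :=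
  'D_((0, basis_vec R i) : 'rV[R]_n * 'rV[R]_n) f.

(* Only the values of [cmap] on [cdom], and of [cinv] on the image of [cdom],
   are relevant. *)
Record chart (R : realType) (n : nat) (M : topologicalType) := Chart {
  cdom : set M;
  cmap : M -> 'rV[R]_n;
  cinv : 'rV[R]_n -> M;
  chart_open_dom : open cdom;
  chart_open_img : open (cmap @` cdom);
  chart_mapK : forall p, cdom p -> cinv (cmap p) = p;
  chart_cont : {within cdom, continuous cmap};
  chart_inv_cont : {within cmap @` cdom, continuous cinv} }.

Definition cimg (R : realType) (n : nat) (M : topologicalType)
  (c : chart R n M) : set 'rV[R]_n := cmap c @` cdom c.

Definition transition (R : realType) (n : nat) (M : topologicalType)
  (a b : chart R n M) : 'rV[R]_n -> 'rV[R]_n := cmap b \o cinv a.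

Definition overlap (R : realType) (n : nat) (M : topologicalType)
  (a b : chart R n M) : set 'rV[R]_n := cmap a @` (cdom a `&` cdom b).

Definition chart_compat (R : realType) (n : nat) (M : topologicalType)
    (a b : chart R n M) : Prop :=
  smooth_on (overlap a b) (transition a b) /\
  smooth_on (overlap b a) (transition b a).

Record manifold (R : realType) (n : nat) := Manifold {
  points :> topologicalType;
  atlas : set (chart R n points);
  manifold_hausdorff : hausdorff_space points;
  manifold_second_countable : @second_countable points;
  atlas_cover : forall p, exists2 c, atlas c & cdom c p;
  atlas_compat : forall a b, atlas a -> atlas b -> chart_compat a b;
  atlas_maximal : forall a,
    (forall b, atlas b -> chart_compat a b) -> atlas a }.

Definition chart_at (R : realType) (n : nat) (M : manifold R n) (p : M)
  (c : chart R n M) : Prop := atlas c /\ cdom c p.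

(* A tangent vector at [p] is the family of its component vectors with respect
   to the charts around [p], related by the differentials of the transition
   maps; the value 0 at the other charts is a convention making equality of
   tangent vectors the right one. *)
Record tangent (R : realType) (n : nat) (M : manifold R n) (p : M) := Tangent {
  tcomp : chart R n M -> 'rV[R]_n;
  tcomp_out : forall c, ~ chart_at p c -> tcomp c = 0;
  tcomp_transition : forall a b, chart_at p a -> chart_at p b ->
    tcomp b = 'd (transition a b) (cmap a p) (tcomp a) }.

Section TangentOfComponents.
Variables (R : realType) (n : nat) (M : manifold R n).
Variables (c : chart R n M) (p : M) (y : 'rV[R]_n).

Definition tvec_comp (b : chart R n M) : 'rV[R]_n :=
  if `[< chart_at p c /\ chart_at p b >]
  then 'd (transition c b) (cmap c p) y else 0.

Lemma tvec_comp_out b : ~ chart_at p b -> tvec_comp b = 0.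
Proof. by move=> nb; rewrite /tvec_comp asboolF // => -[]. Qed.

Lemma open_overlap (a b : chart R n M) : open (overlap a b).
Proof.
have -> : overlap a b = cimg a `&` cinv a @^-1` cdom b.
  rewrite /overlap /cimg; apply/seteqP; split => [_ [q [aq bq] <-]|].
    by split; [exists q | rewrite /= chart_mapK].
  by move=> _ [[q aq <-] /=]; rewrite chart_mapK // => bq; exists q.
have oa : open (cimg a) := @chart_open_img _ _ _ a.
apply: ((continuous_inP _ oa).1 _ _ (@chart_open_dom _ _ _ b)).
by rewrite -continuous_open_subspace //; exact: chart_inv_cont.
Qed.

Lemma differentiable_transition (a b : chart R n M) : chart_at p a ->
  chart_at p b -> differentiable (transition a b) (cmap a p).
Proof.
move=> [aa ap] [ab bp]; have [/(_ 1%N)[+ _] _] := atlas_compat aa ab.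
by apply; exists p.
Qed.

Lemma tvec_comp_transition a b : chart_at p a -> chart_at p b ->
  tvec_comp b = 'd (transition a b) (cmap a p) (tvec_comp a).
Proof.
move=> pa pb; rewrite /tvec_comp.
have [pc|npc] := pselect (chart_at p c); last first.
  by rewrite !asboolF ?linear0 // => -[].
rewrite !asboolT //.
have dca := differentiable_transition pc pa.
have dcb := differentiable_transition pc pb.
have dab := differentiable_transition pa pb.
have E : transition c a (cmap c p) = cmap a p.
  by rewrite /transition /= chart_mapK //; case: pc.
have nE : \forall x \near cmap c p,
    transition c b x = (transition a b \o transition c a) x.
  near=> x.
  have [q [cq aq] <-] : overlap c a x.
    near: x; apply: open_nbhs_nbhs; split; first exact: open_overlap.
    by exists p => //; split; [case: pc | case: pa].
  by rewrite /transition /= !chart_mapK.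
have dab' : differentiable (transition a b) (transition c a (cmap c p)).
  by rewrite E.
have dcomp := differentiable_comp dca dab'.
apply: (etrans (esym (deriveE y dcb))).
apply: (etrans (near_eq_derive y nE)).
apply: (etrans (deriveE y dcomp)).
have H := diff_comp dca dab'.
apply: (etrans (congr1 (fun f => f y) H)).
by move: dab' {dcomp H}; rewrite E.
Unshelve. all: by end_near. Qed.

(* The tangent vector at [p] with components [y] in the chart [c]
   (zero if [c] is not a chart around [p]). *)
Definition tvec : tangent p := Tangent tvec_comp_out tvec_comp_transition.

End TangentOfComponents.

(* Coordinate expression on cimg c x R^n of a function on the tangent bundle. *)
Definition local_fun (R : realType) (n : nat) (M : manifold R n)
    (f : forall p : M, tangent p -> R) (c : chart R n M)
    (z : 'rV[R]_n * 'rV[R]_n) : R :=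
  f (cinv c z.1) (tvec c (cinv c z.1) z.2).

Record finsler (R : realType) (n : nat) (M : manifold R n) := Finsler {
  finsler_fun :> forall p : M, tangent p -> R;
  finsler_cont : forall c, atlas c -> forall z, cimg c z.1 ->
    {for z, continuous (local_fun finsler_fun c)};
  finsler_smooth : forall c, atlas c ->
    smooth_on [set z : 'rV[R]_n * 'rV[R]_n | cimg c z.1 /\ z.2 != 0]
      (local_fun finsler_fun c);
  finsler_homogeneous : forall c, atlas c -> forall x y (t : R),
    cimg c x -> 0 < t ->
    local_fun finsler_fun c (x, t *: y) = t * local_fun finsler_fun c (x, y);
  finsler_hessian : forall c, atlas c -> forall x y, cimg c x -> y != 0 ->
    forall w : 'rV[R]_n, w != 0 ->
    0 < \sum_(i < n) \sum_(j < n) w 0 i * w 0 j *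
          dfib i (dfib j (fun z => local_fun finsler_fun c z ^+ 2 / 2)) (x, y)
}.

Definition metric_mx (R : realType) (n : nat) (M : manifold R n)
    (g : forall p : M, tangent p -> tangent p -> R) (c : chart R n M)
    (x : 'rV[R]_n) : 'M[R]_n :=
  \matrix_(i < n, j < n) g (cinv c x) (tvec c (cinv c x) (basis_vec R i))
                                      (tvec c (cinv c x) (basis_vec R j)).

Record riemannian (R : realType) (n : nat) (M : manifold R n) := Riemannian {
  riemannian_fun :> forall p : M, tangent p -> tangent p -> R;
  riemannian_bilinear : forall c, atlas c -> forall x y z, cimg c x ->
    riemannian_fun (tvec c (cinv c x) y) (tvec c (cinv c x) z) =
    \sum_(i < n) \sum_(j < n)
      y 0 i * z 0 j * metric_mx riemannian_fun c x i j;
  riemannian_sym : forall (p : M) (v w : tangent p),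
    riemannian_fun v w = riemannian_fun w v;
  riemannian_pos : forall c, atlas c -> forall x y, cimg c x -> y != 0 ->
    0 < riemannian_fun (tvec c (cinv c x) y) (tvec c (cinv c x) y);
  riemannian_smooth : forall c, atlas c -> forall i j,
    smooth_on (cimg c)
      ((fun x => metric_mx riemannian_fun c x i j) : 'rV[R]_n -> R) }.

Definition is_riemannian (R : realType) (n : nat) (M : manifold R n)
    (F : finsler M) : Prop :=
  exists g : riemannian M, forall (p : M) (v : tangent p), F p v ^+ 2 = g p v v.

Definition metric_inv (R : realType) (n : nat) (M : manifold R n)
    (g : riemannian M) (c : chart R n M) (x : 'rV[R]_n) : 'M[R]_n :=
  invmx (metric_mx g c x).

(* [christoffel g c x i j k] is Gamma^{*k}_{ij}. *)
Definition christoffel (R : realType) (n : nat) (M : manifold R n)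
    (g : riemannian M) (c : chart R n M) (x : 'rV[R]_n) (i j k : 'I_n) : R :=
  2^-1 * \sum_(l < n) metric_inv g c x k l *
    (dpart i ((fun x' => metric_mx g c x' j l) : 'rV[R]_n -> R) x +
     dpart j ((fun x' => metric_mx g c x' i l) : 'rV[R]_n -> R) x -
     dpart l ((fun x' => metric_mx g c x' i j) : 'rV[R]_n -> R) x).

(* A linear connection is given by its connection parameters in the charts:
   [conn_coef c x i j k] is Gamma^k_{ij}, the k-th component of the covariant
   derivative of the j-th coordinate field in the direction of the i-th one. *)
Record connection (R : realType) (n : nat) (M : manifold R n) := Connection {
  conn_coef : chart R n M -> 'rV[R]_n -> 'I_n -> 'I_n -> 'I_n -> R;
  conn_smooth : forall c, atlas c -> forall i j k,
    smooth_on (cimg c) ((fun x => conn_coef c x i j k) : 'rV[R]_n -> R);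
  conn_transition : forall a b, atlas a -> atlas b ->
    forall x, overlap a b x -> forall i j k,
    \sum_(r < n) \sum_(s < n) conn_coef b (transition a b x) r s k *
        dpart i (transition a b) x 0 r * dpart j (transition a b) x 0 s =
    \sum_(r < n) dpart r (transition a b) x 0 k * conn_coef a x i j r
      - dpart i (dpart j (transition a b)) x 0 k }.

Definition torsion (R : realType) (n : nat) (M : manifold R n)
    (nabla : connection M) (c : chart R n M) (x : 'rV[R]_n) (i j k : 'I_n) : R :=
  conn_coef nabla c x i j k - conn_coef nabla c x j i k.

Definition metrical (R : realType) (n : nat) (M : manifold R n)
    (g : riemannian M) (nabla : connection M) : Prop :=
  forall c, atlas c -> forall x, cimg c x -> forall i j k : 'I_n,
    dpart i ((fun x' => metric_mx g c x' j k) : 'rV[R]_n -> R) x =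
    \sum_(l < n) (conn_coef nabla c x i j l * metric_mx g c x l k +
                  conn_coef nabla c x i k l * metric_mx g c x j l).

Definition smooth_curve (R : realType) (n : nat) (M : manifold R n)
    (c : R -> M) (a b : R) : Prop :=
  (forall t, a < t < b -> {for t, continuous c}) /\
  (forall k : chart R n M, atlas k ->
    smooth_on [set t : R | a < t < b /\ cdom k (c t)] (cmap k \o c)).

Definition parallel_along (R : realType) (n : nat) (M : manifold R n)
    (nabla : connection M) (c : R -> M) (a b : R)
    (X : forall t, tangent (c t)) : Prop :=
  forall k, atlas k -> forall t, a < t < b -> cdom k (c t) -> forall r : 'I_n,
    is_derive t (1 : R) (fun s => tcomp (X s) k 0 r : R)
      (- \sum_(i < n) \sum_(j < n) conn_coef nabla k (cmap k (c t)) i j r *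
           derive1 (cmap k \o c) t 0 i * tcomp (X t) k 0 j).

(* Invariance of F under the parallel transports along smooth curves defined on
   open intervals covers the transports along piecewise smooth arcs. *)
Definition compatible (R : realType) (n : nat) (M : manifold R n)
    (F : finsler M) (nabla : connection M) : Prop :=
  forall (c : R -> M) (a b : R) (X : forall t, tangent (c t)),
    smooth_curve c a b -> parallel_along nabla a b X ->
    forall s t, a < s < b -> a < t < b -> F (c s) (X s) = F (c t) (X t).

Definition generalized_Berwald (R : realType) (n : nat) (M : manifold R n)
    (F : finsler M) : Prop := exists nabla : connection M, compatible F nabla.

Definition compatible_metric (R : realType) (n : nat) (M : manifold R n)
    (F : finsler M) (g : riemannian M) : Prop :=
  forall nabla : connection M, compatible F nabla -> metrical g nabla.

(* The horizontal derivative X_i^{h*} F at the point with induced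
   coordinates [z]. *)
Definition hderiv (R : realType) (n : nat) (M : manifold R n) (F : finsler M)
    (g : riemannian M) (c : chart R n M) (i : 'I_n)
    (z : 'rV[R]_n * 'rV[R]_n) : R :=
  dbase i (local_fun F c) z -
  \sum_(j < n) \sum_(k < n)
    z.2 0 j * christoffel g c z.1 i j k * dfib k (local_fun F c) z.

(* Components [T a b c] = T_{ab}^c of an element of wedge^2 T*_pM (x) T_pM. *)
Definition antisym (R : realType) (n : nat)
    (T : 'I_n -> 'I_n -> 'I_n -> R) : Prop :=
  forall a b c, T a b c = - T b a c.

Definition compatibility_eqs (R : realType) (n : nat) (M : manifold R n)
    (F : finsler M) (g : riemannian M) (p : M) (c : chart R n M)
    (T : 'I_n -> 'I_n -> 'I_n -> R) : Prop :=
  let x := cmap c p in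
  let gam := metric_mx g c x in
  let gaminv := metric_inv g c x in
  forall (y : 'rV[R]_n), y != 0 -> forall i : 'I_n,
    \sum_(j < n) \sum_(r < n) y 0 j *
      (\sum_(k < n) \sum_(l < n) (T j k l * gaminv k r * gam i l +
                                  T i k l * gaminv k r * gam j l) - T i j r) *
      dfib r (local_fun F c) (x, y)
    = - 2 * hderiv F g c i (x, y).

Definition compatible_torsion (R : realType) (n : nat) (M : manifold R n)
    (F : finsler M) (g : riemannian M) (p : M) (c : chart R n M)
    (T : 'I_n -> 'I_n -> 'I_n -> R) : Prop :=
  antisym T /\ compatibility_eqs F g p c T.

Definition orthonormal_at (R : realType) (n : nat) (M : manifold R n)
    (g : riemannian M) (p : M) (c : chart R n M) : Prop :=
  forall i j : 'I_n,
    g p (tvec c p (basis_vec R i)) (tvec c p (basis_vec R j)) = (i == j)%:R.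

Definition torsion_sqnorm (R : realType) (n : nat)
    (T : 'I_n -> 'I_n -> 'I_n -> R) : R :=
  \sum_(i < n) \sum_(j < n | (i < j)%N) \sum_(k < n) T i j k ^+ 2.

Definition extremal_compatible (R : realType) (n : nat) (M : manifold R n)
    (F : finsler M) (g : riemannian M) (nabla : connection M) : Prop :=
  compatible F nabla /\
  forall (p : M) (c : chart R n M), chart_at p c -> orthonormal_at g p c ->
    compatible_torsion F g p c (torsion nabla c (cmap c p)) /\
    forall T, compatible_torsion F g p c T ->
      torsion_sqnorm (torsion nabla c (cmap c p)) <= torsion_sqnorm T.

Definition i1 : 'I_3 := @Ordinal 3 0 isT.
Definition i2 : 'I_3 := @Ordinal 3 1 isT.
Definition i3 : 'I_3 := @Ordinal 3 2 isT.

Definition vec3 (R : realType) (a b c : R) : 'rV[R]_3 :=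
  \row_(i < 3) [:: a; b; c]`_i.

(* The library norm on row vectors is the maximum norm. *)
Definition dot (R : realType) (v w : 'rV[R]_3) : R :=
  \sum_(i < 3) v 0 i * w 0 i.

Definition enorm (R : realType) (v : 'rV[R]_3) : R := Num.sqrt (dot v v).

Definition cross (R : realType) (v w : 'rV[R]_3) : 'rV[R]_3 :=
  vec3 (v 0 i2 * w 0 i3 - v 0 i3 * w 0 i2)
       (v 0 i3 * w 0 i1 - v 0 i1 * w 0 i3)
       (v 0 i1 * w 0 i2 - v 0 i2 * w 0 i1).

(* Frenet-Serret apparatus of a curve parametrized by arc length. *)
Definition frenet_T (R : realType) (c : R -> 'rV[R]_3) : R -> 'rV[R]_3 := derive1 c.

Definition curvature (R : realType) (c : R -> 'rV[R]_3) (t : R) : R :=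
  enorm (derive1 (frenet_T c) t).

Definition frenet_N (R : realType) (c : R -> 'rV[R]_3) (t : R) : 'rV[R]_3 :=
  (curvature c t)^-1 *: derive1 (frenet_T c) t.

Definition frenet_B (R : realType) (c : R -> 'rV[R]_3) (t : R) : 'rV[R]_3 :=
  cross (frenet_T c t) (frenet_N c t).

(* The vector fields on T_pM \ {0}, identified with R^3 \ {0} by means of the
    chart [c]: the position field C is the identity, and G = grad F. *)

Definition gradF (R : realType) (M : manifold R 3) (F : finsler M) (p : M)
    (c : chart R 3 M) (w : 'rV[R]_3) : 'rV[R]_3 :=
  \row_(i < 3) dfib i (local_fun F c) (cmap c p, w).

Definition CxG (R : realType) (M : manifold R 3) (F : finsler M) (p : M)
    (c : chart R 3 M) (w : 'rV[R]_3) : 'rV[R]_3 := cross w (gradF F p c w).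

Definition vertical_contact (R : realType) (M : manifold R 3) (F : finsler M)
    (p : M) (c : chart R 3 M) (w : 'rV[R]_3) : Prop :=
  w != 0 /\ CxG F p c w = 0.

Definition integral_curve (R : realType) (M : manifold R 3) (F : finsler M)
    (p : M) (c : chart R 3 M) (v : 'rV[R]_3) (eps : R)
    (c0 : R -> 'rV[R]_3) : Prop :=
  c0 0 = v /\
  forall t, - eps < t < eps ->
    [/\ c0 t != 0, ~ vertical_contact F p c (c0 t) &
        is_derive t (1 : R) c0
          ((enorm (CxG F p c (c0 t)))^-1 *: CxG F p c (c0 t))].

Definition b0 (R : realType) (M : manifold R 3) (F : finsler M)
    (g : riemannian M) (p : M) (c : chart R 3 M) (i : 'I_3)
    (w : 'rV[R]_3) : R :=
  - 2 * hderiv F g c i (cmap c p, w) / enorm (CxG F p c w).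

(* [PQR i] is P, Q, R for i = 1, 2, 3; division by the curvature is total,
   but the curvature of an integral curve is positive. *)
Definition PQR (R : realType) (M : manifold R 3) (F : finsler M)
    (g : riemannian M) (p : M) (c : chart R 3 M) (c0 : R -> 'rV[R]_3)
    (i : 'I_3) : 'rV[R]_3 :=
  2^-1 *: (b0 F g p c i (c0 0) *: frenet_T c0 0 +
           (derive1 (b0 F g p c i \o c0) 0 / curvature c0 0) *: frenet_N c0 0).

(* [S] is the vector R; [T a b c] is T_{ab}^c. *)
Definition torsion_components (R : realType) (D P Q S : 'rV[R]_3) (s t u : R)
    (T : 'I_3 -> 'I_3 -> 'I_3 -> R) : Prop :=
  [/\ [/\ T i1 i3 i1 = - P 0 i2 - s * D 0 i2,
          T i2 i3 i2 = Q 0 i1 + t * D 0 i1 &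
          T i2 i3 i3 = S 0 i1 + u * D 0 i1],
      [/\ T i1 i2 i1 = P 0 i3 + s * D 0 i3,
          T i1 i2 i2 = Q 0 i3 + t * D 0 i3 &
          T i1 i3 i3 = - S 0 i2 - u * D 0 i2] &
      [/\ T i1 i2 i3 = - P 0 i1 - Q 0 i2 - s * D 0 i1 - t * D 0 i2,
          T i1 i3 i2 = P 0 i1 + S 0 i3 + s * D 0 i1 + u * D 0 i3 &
          T i2 i3 i1 = - Q 0 i2 - S 0 i3 - t * D 0 i2 - u * D 0 i3]].

(* Main.v *)
(* The compatibility equations say that for each i the skew form
   [T_jr^i + T_ir^j - T_ij^r] is represented by a vector a_i whose product with
   C x G is [-2 X_i^{h*} F].  Along the integral curve [c0] of the normalized
   field this reads <a_i, c0'> = b_i^0, and differentiating at 0 gives the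
   normal component of a_i, so a_i is known up to a multiple of the binormal D.
   The curvature is positive because |c0| is constant: <c0, c0'> = 0 yields
   <c0, c0''> = -1.  The same differentiation applied to a generator of the
   one-dimensional annihilator of the vectors C x G shows that D spans it, hence
   adding multiples of D to a solution gives a solution.  The extremal torsion
   is then the minimum of a strictly convex quadratic polynomial in (s, t, u). *)

Require Import Defs.
From mathcomp Require Import all_boot all_order all_algebra.
From mathcomp Require Import all_classical all_reals all_analysis.
From mathcomp Require Import ring lra.
Import Order.TTheory GRing.Theory Num.Theory.
Import numFieldNormedType.Exports.
Local Open Scope classical_set_scope.
Local Open Scope ring_scope.

(** * Euclidean vector algebra in R^3 *)

Section Vectors.
Context {R : realType}.
Implicit Types (a b v w : 'rV[R]_3).

Lemma sum3E (V : zmodType) (f : 'I_3 -> V) : \sum_(i < 3) f i = f i1 + f i2 + f i3.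
Proof.
rewrite !big_ord_recl big_ord0 addr0 addrA.
by congr (f _ + f _ + f _); exact: val_inj.
Qed.

Lemma ord3P (i : 'I_3) : [\/ i = i1, i = i2 | i = i3].
Proof.
by case: i => -[|[|[|//]]] h; [apply: Or31|apply: Or32|apply: Or33]; exact: val_inj.
Qed.

Lemma rowP3 a b : a 0 i1 = b 0 i1 -> a 0 i2 = b 0 i2 -> a 0 i3 = b 0 i3 -> a = b.
Proof. by move=> *; apply/rowP => i; have [->|->|->] := ord3P i. Qed.

Lemma vec3E (x y z : R) :
  (vec3 x y z 0 i1 = x) * (vec3 x y z 0 i2 = y) * (vec3 x y z 0 i3 = z).
Proof. by rewrite !mxE. Qed.

Lemma crossE a b :
  (cross a b 0 i1 = a 0 i2 * b 0 i3 - a 0 i3 * b 0 i2) *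
  (cross a b 0 i2 = a 0 i3 * b 0 i1 - a 0 i1 * b 0 i3) *
  (cross a b 0 i3 = a 0 i1 * b 0 i2 - a 0 i2 * b 0 i1).
Proof. by rewrite !vec3E. Qed.

Lemma dotE a b :
  dot a b = a 0 i1 * b 0 i1 + a 0 i2 * b 0 i2 + a 0 i3 * b 0 i3.
Proof. exact: sum3E. Qed.

Lemma dotC a b : dot a b = dot b a.
Proof. by rewrite !dotE; ring. Qed.

Lemma dotDr a b v : dot a (b + v) = dot a b + dot a v.
Proof. by rewrite !dotE !mxE; ring. Qed.

Lemma dotZr (k : R) a b : dot a (k *: b) = k * dot a b.
Proof. by rewrite !dotE !mxE; ring. Qed.

Lemma dot0r a : dot a 0 = 0.
Proof. by rewrite -(scale0r a) dotZr mul0r. Qed.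

Lemma dotDl a b v : dot (a + b) v = dot a v + dot b v.
Proof. by rewrite !(dotC _ v) dotDr. Qed.

Lemma dotZl (k : R) a b : dot (k *: a) b = k * dot a b.
Proof. by rewrite !(dotC _ b) dotZr. Qed.

Lemma dot_cross_l a b : dot a (cross a b) = 0.
Proof. by rewrite !dotE !crossE; ring. Qed.

Lemma dot_ge0 a : 0 <= dot a a.
Proof. by rewrite dotE -!expr2 !addr_ge0 // sqr_ge0. Qed.

Lemma dot_eq0 a : (dot a a == 0) = (a == 0).
Proof.
apply/idP/eqP => [|->]; last by rewrite dotE !mxE !mul0r !addr0.
rewrite dotE -!expr2 !paddr_eq0 ?addr_ge0 ?sqr_ge0 // !sqrf_eq0.
by move=> /andP[/andP[/eqP h1 /eqP h2] /eqP h3]; apply: rowP3; rewrite ?h1 ?h2 ?h3 mxE.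
Qed.

Lemma dot_gt0 a : a != 0 -> 0 < dot a a.
Proof. by move=> a0; rewrite lt_def dot_eq0 a0 dot_ge0. Qed.

Lemma enorm_sqr a : enorm a ^+ 2 = dot a a.
Proof. by rewrite sqr_sqrtr ?dot_ge0. Qed.

Lemma enorm_gt0 a : a != 0 -> 0 < enorm a.
Proof. by move=> a0; rewrite sqrtr_gt0 dot_gt0. Qed.

Lemma dot_normalize a : a != 0 ->
  dot ((enorm a)^-1 *: a) ((enorm a)^-1 *: a) = 1.
Proof.
move=> a0; rewrite dotZl dotZr -enorm_sqr mulrA -expr2 -exprMn mulVf ?expr1n //.
by rewrite gt_eqF ?enorm_gt0.
Qed.

(* Holds for all vectors; for orthonormal [v], [w] it is the expansion of [a]
   in the frame [v], [w], [v x w]. *)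
Lemma gram_cross_expand a v w :
  (dot v v * dot w w - dot v w ^+ 2) *: a =
  (dot a v * dot w w - dot a w * dot v w) *: v +
  (dot a w * dot v v - dot a v * dot v w) *: w + dot a (cross v w) *: cross v w.
Proof. by apply: rowP3; rewrite !mxE !dotE !crossE /=; ring. Qed.

Lemma frame_expand a v w : dot v v = 1 -> dot w w = 1 -> dot v w = 0 ->
  a = dot a v *: v + dot a w *: w + dot a (cross v w) *: cross v w.
Proof.
move=> vv ww vw; have := gram_cross_expand a v w.
by rewrite vv ww vw expr0n /= !mulr1 !mulr0 !subr0 scale1r.
Qed.

Lemma cross_orthonormal v w : dot v v = 1 -> dot w w = 1 -> dot v w = 0 ->
  dot (cross v w) (cross v w) = 1.
Proof.
move=> vv ww vw; transitivity (dot v v * dot w w - dot v w ^+ 2).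
  by rewrite !dotE !crossE; ring.
by rewrite vv ww vw mulr1 expr0n subr0.
Qed.

End Vectors.

(** * Derivatives of curves in R^3 *)

Section Curves.
Context {R : realType}.
Implicit Types (c f g : R -> 'rV[R]_3) (t : R).

Lemma is_derive_coord {n} (f : R -> 'rV[R]_n) df t i :
  is_derive t (1 : R) f df -> is_derive t (1 : R) (fun s => f s 0 i) (df 0 i).
Proof.
move=> [dfP <-]; rewrite derive_mx // mxE; apply: derivableP.
exact: (derivable_mxP _ _ _).1.
Qed.

Lemma is_derive_dot f g df dg t :
  is_derive t (1 : R) f df -> is_derive t (1 : R) g dg ->
  is_derive t (1 : R) (fun s => dot (f s) (g s)) (dot df (g t) + dot (f t) dg).
Proof.
move=> fP gP; rewrite [X in is_derive _ _ X _](_ : _ =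
   (fun s => f s 0 i1) * (fun s => g s 0 i1) + (fun s => f s 0 i2) * (fun s => g s 0 i2)
   + (fun s => f s 0 i3) * (fun s => g s 0 i3)); last first.
  by apply/funext => s; rewrite dotE.
have fi i := is_derive_coord _ _ _ i fP; have gi i := is_derive_coord _ _ _ i gP.
apply: (is_derive_eq (is_deriveD (is_deriveD (is_deriveM (fi i1) (gi i1))
  (is_deriveM (fi i2) (gi i2))) (is_deriveM (fi i3) (gi i3)))).
by rewrite /GRing.scale /= !dotE; ring.
Qed.

Lemma derivable_cross f g t : derivable f t (1 : R) -> derivable g t (1 : R) ->
  derivable (fun s => cross (f s) (g s)) t (1 : R).
Proof.
move=> /derivable_mxP fP /derivable_mxP gP; apply/derivable_mxP => i j.
rewrite ord1; have [->|->|->] := ord3P j; under eq_fun do rewrite crossE;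
  by apply: derivableB; apply: derivableM.
Qed.

Lemma derivable_normalize f t : f t != 0 -> derivable f t (1 : R) ->
  derivable (fun s => (enorm (f s))^-1 *: f s) t (1 : R).
Proof.
move=> f0 fP; have /derivable_mxP fiP := fP.
have f0' := dot_gt0 _ f0.
have eP : derivable (fun s => enorm (f s)) t (1 : R).
  have [dP _] := is_derive_dot _ _ _ _ _ (derivableP fP) (derivableP fP).
  apply/derivable1_diffP; apply: (@differentiable_comp _ _ _ _ (fun s => dot (f s) (f s)) Num.sqrt).
    exact/derivable1_diffP.
  by apply/derivable1_diffP; case: (is_derive1_sqrt f0').
apply/derivable_mxP => i j; under eq_fun do rewrite mxE.
by apply: derivableM (fiP i j); apply: derivableV eP; rewrite gt_eqF ?enorm_gt0.
Qed.

Lemma near_itv0 (eps : R) (P : R -> Prop) : 0 < eps ->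
  (forall t, - eps < t < eps -> P t) -> \forall t \near (0 : R), P t.
Proof.
move=> e0 H; have : \forall t \near (0 : R), t \in `]- eps, eps[.
  by apply: near_in_itvoo; rewrite in_itv /= oppr_lt0 e0.
by apply: filterS => t; rewrite in_itv /=; exact: H.
Qed.

(** * Frenet frame at 0 of a unit-speed curve on a sphere about the origin *)

Section SphericalCurve.
Context {c : R -> 'rV[R]_3}.
Hypothesis c_deriv : \forall t \near (0 : R), derivable c t (1 : R).
Hypothesis c_unit : \forall t \near (0 : R), dot (frenet_T c t) (frenet_T c t) = 1.
Hypothesis c_sphere : \forall t \near (0 : R), dot (c t) (frenet_T c t) = 0.
Hypothesis T_deriv : derivable (frenet_T c) 0 (1 : R).

Let T0 := frenet_T c 0.
Let T1 := derive1 (frenet_T c) 0.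

Let T_is_derive : is_derive (0 : R) (1 : R) (frenet_T c) T1.
Proof. by rewrite /T1 derive1E; exact: derivableP. Qed.

Lemma derive1_near_cst (f : R -> R) (df k : R) : (\forall t \near (0 : R), f t = k) ->
  is_derive (0 : R) (1 : R) f df -> df = 0.
Proof.
move=> fk fP; have [_ <-] := fP.
by rewrite (@near_eq_derive _ _ _ f (cst k) 0 1 fk) derive_cst.
Qed.

Lemma frenet_TT : dot T0 T0 = 1.
Proof. exact: (nbhs_singleton c_unit). Qed.

Lemma frenet_T_orth_T' : dot T0 T1 = 0.
Proof.
have := derive1_near_cst _ _ _ c_unit (is_derive_dot _ _ _ _ _ T_is_derive T_is_derive).
by rewrite -/T0 (dotC T1); lra.
Qed.

Lemma spherical_curvature_gt0 : 0 < curvature c 0.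
Proof.
apply: enorm_gt0; apply/eqP => T10.
have cP : is_derive (0 : R) (1 : R) c T0.
  by rewrite /T0 /frenet_T derive1E; apply: derivableP; exact: (nbhs_singleton c_deriv).
(* Differentiating [c_sphere] gives <T, T> + <c, T'> = 0, which for T' = 0 contradicts <T, T> =
   1. *)
have := derive1_near_cst _ _ _ c_sphere (is_derive_dot _ _ _ _ _ cP T_is_derive).
rewrite /T1 T10 frenet_TT dot0r; lra.
Qed.

Lemma frenet_NN : dot (frenet_N c 0) (frenet_N c 0) = 1.
Proof.
apply: dot_normalize; apply: contraTneq spherical_curvature_gt0 => T10.
by rewrite /curvature T10 /enorm dot0r sqrtr0 ltxx.
Qed.

Lemma frenet_TN : dot T0 (frenet_N c 0) = 0.
Proof. by rewrite dotZr frenet_T_orth_T' mulr0. Qed.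

Lemma frenet_BB : dot (frenet_B c 0) (frenet_B c 0) = 1.
Proof. exact: cross_orthonormal frenet_TT frenet_NN frenet_TN. Qed.

(* A constant vector is determined up to a multiple of the binormal by its
   inner product with the tangent near 0: differentiating that product gives
   the normal component. *)
Lemma frenet_expand a (b : R -> R) :
  (\forall t \near (0 : R), dot a (frenet_T c t) = b t) ->
  a = b 0 *: T0 + (derive1 b 0 / curvature c 0) *: frenet_N c 0 +
      dot a (frenet_B c 0) *: frenet_B c 0.
Proof.
move=> ab; rewrite {1}(frame_expand a _ _ frenet_TT frenet_NN frenet_TN).
rewrite -/(frenet_B c 0) (nbhs_singleton ab) dotZr; congr (_ + _ *: _ + _).
  (* Since N = T' / kappa, it remains to identify <a, T'> with b'(0): both are derivatives at 0 of
     functions that agree near 0. *)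
  rewrite mulrC; congr (_ / _); rewrite [RHS]derive1E.
  rewrite -(@near_eq_derive R R R _ _ 0 1 ab).
  have aP : is_derive (0 : R) (1 : R) (cst a) 0 by exact: is_derive_cst.
  have [_ ->] := is_derive_dot _ _ _ _ _ aP T_is_derive.
  by rewrite [dot 0 _]dotC dot0r add0r.
Qed.

End SphericalCurve.
End Curves.

(** * Torsions as triples of vectors, and the least norm *)

Section Torsion.
Context {R : realType}.
Implicit Types (T : 'I_3 -> 'I_3 -> 'I_3 -> R) (D P Q S : 'rV[R]_3).

(** The bracket of the compatibility equations when gamma is the identity matrix; -1/2 times it is
    the deviation of the metrical connection with torsion [T] from the Levi-Civita connection. *)
Definition contorsion_form T (i j r : 'I_3) : R := T j r i + T i r j - T i j r.

(* At a point where the metric is the identity, the skew form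
   [contorsion_form T i] is the triple product with this vector. *)
Definition contorsion_vec T (i : 'I_3) : 'rV[R]_3 :=
  vec3 (contorsion_form T i i2 i3) (contorsion_form T i i3 i1)
       (contorsion_form T i i1 i2).

Lemma contorsion_form_skew T i j r : antisym T ->
  contorsion_form T i r j = - contorsion_form T i j r.
Proof. by move=> Ta; rewrite /contorsion_form (Ta r j i); ring. Qed.

(** In dimension three a skew form is determined by its entries 23, 31, 12, taken here as
    coordinates of a vector. For [w] = grad F at [y] the sum is the left side of the compatibility
    equations. *)
Lemma contorsion_vecP T i (y w : 'rV[R]_3) : antisym T ->
  \sum_(j < 3) \sum_(r < 3) y 0 j * contorsion_form T i j r * w 0 r =
  dot (contorsion_vec T i) (cross y w).
Proof.
move=> Ta; rewrite !sum3E !dotE !crossE /contorsion_vec !vec3E.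
have skew j r := contorsion_form_skew T i j r Ta.
have diag j : contorsion_form T i j j = 0 by have := skew j j; lra.
by rewrite !diag (skew i1 i2) (skew i2 i3) (skew i3 i1); ring.
Qed.

Lemma antisym_diag T a c : antisym T -> T a a c = 0.
Proof. by move=> Ta; have := Ta a a c; lra. Qed.

(** Passing from an antisymmetric [T] to its three vectors is a linear bijection of nine-dimensional
    spaces, and the nine component formulas are its inverse. Each parameter moves one vector along
    [D]. *)
Lemma torsion_componentsP D P Q S s t r T : antisym T ->
  torsion_components D P Q S s t r T <->
  [/\ contorsion_vec T i1 = 2 *: P + (2 * s) *: D,
      contorsion_vec T i2 = 2 *: Q + (2 * t) *: D &
      contorsion_vec T i3 = 2 *: S + (2 * r) *: D].
Proof.
move=> Ta.
have diag a c : T a a c = 0 := antisym_diag T a c Ta.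
have t21 := Ta i2 i1; have t31 := Ta i3 i1; have t32 := Ta i3 i2.
have vecP i v : contorsion_vec T i = v <-> [/\ contorsion_form T i i2 i3 = v 0 i1,
    contorsion_form T i i3 i1 = v 0 i2 & contorsion_form T i i1 i2 = v 0 i3].
  by split=> [<-|[]]; [rewrite /contorsion_vec !vec3E|
    move=> *; apply: rowP3; rewrite /contorsion_vec !vec3E].
split=> [[[? ? ?] [? ? ?] [? ? ?]]|[/vecP[+ + +] /vecP[+ + +] /vecP[+ + +]]].
  by split; apply/vecP; rewrite /contorsion_form !mxE ?t21 ?t31 ?t32 ?diag;
    split; lra.
rewrite /contorsion_form !mxE ?t21 ?t31 ?t32 ?diag => *.
by split; split; lra.
Qed.

Lemma torsion_components_exists D P Q S s t r :
  exists2 T, antisym T & torsion_components D P Q S s t r T.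
Proof.
pose p := P + s *: D; pose q := Q + t *: D; pose u := S + r *: D.
(* The coordinates of [V k] are T_23^k, T_31^k, T_12^k, so that T_ab^k = <e_a x e_b, [V k]>. *)
pose V (k : 'I_3) := [:: vec3 (- q 0 i2 - u 0 i3) (p 0 i2) (p 0 i3);
  vec3 (q 0 i1) (- p 0 i1 - u 0 i3) (q 0 i3);
  vec3 (u 0 i1) (u 0 i2) (- p 0 i1 - q 0 i2)]`_k.
exists (fun a b k => dot (cross (basis_vec R a) (basis_vec R b)) (V k)).
  by move=> a b k; rewrite !dotE !crossE; ring.
by split; split; rewrite !dotE !crossE /V /= !vec3E /basis_vec !mxE /=; ring.
Qed.

Lemma torsion_sqnorm3E T : torsion_sqnorm T =
  T i1 i2 i1 ^+ 2 + T i1 i2 i2 ^+ 2 + T i1 i2 i3 ^+ 2 +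
  T i1 i3 i1 ^+ 2 + T i1 i3 i2 ^+ 2 + T i1 i3 i3 ^+ 2 +
  T i2 i3 i1 ^+ 2 + T i2 i3 i2 ^+ 2 + T i2 i3 i3 ^+ 2.
Proof.
rewrite /torsion_sqnorm; under eq_bigr do rewrite big_mkcond /=.
by rewrite !sum3E /=; ring.
Qed.

Lemma torsion_components_sqnorm D P Q S s t r T :
  torsion_components D P Q S s t r T -> torsion_sqnorm T =
  (P 0 i3 + s * D 0 i3) ^+ 2 + (Q 0 i3 + t * D 0 i3) ^+ 2 +
  (P 0 i1 + Q 0 i2 + s * D 0 i1 + t * D 0 i2) ^+ 2 +
  (P 0 i2 + s * D 0 i2) ^+ 2 +
  (P 0 i1 + S 0 i3 + s * D 0 i1 + r * D 0 i3) ^+ 2 +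
  (S 0 i2 + r * D 0 i2) ^+ 2 +
  (Q 0 i2 + S 0 i3 + t * D 0 i2 + r * D 0 i3) ^+ 2 +
  (Q 0 i1 + t * D 0 i1) ^+ 2 + (S 0 i1 + r * D 0 i1) ^+ 2.
Proof.
move=> [[e1 e2 e3] [e4 e5 e6] [e7 e8 e9]].
by rewrite torsion_sqnorm3E e1 e2 e3 e4 e5 e6 e7 e8 e9; ring.
Qed.

(* In the parameters the squared norm is a quadratic polynomial with gradient
   [a + 2 (|D|^2 I + D D^T) x] and positive definite quadratic part. *)
Lemma torsion_components_minimal D P Q S s t r s0 t0 r0 T T' :
  dot D D = 1 ->
  4 * D 0 i1 * P 0 i1 + 2 * D 0 i1 * Q 0 i2 + 2 * D 0 i1 * S 0 i3
    + 2 * D 0 i2 * P 0 i2 + 2 * D 0 i3 * P 0 i3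
    + 2 * (s0 + D 0 i1 * (s0 * D 0 i1 + t0 * D 0 i2 + r0 * D 0 i3)) = 0 ->
  2 * D 0 i1 * Q 0 i1 + 2 * D 0 i2 * P 0 i1 + 4 * D 0 i2 * Q 0 i2
    + 2 * D 0 i2 * S 0 i3 + 2 * D 0 i3 * Q 0 i3
    + 2 * (t0 + D 0 i2 * (s0 * D 0 i1 + t0 * D 0 i2 + r0 * D 0 i3)) = 0 ->
  2 * D 0 i1 * S 0 i1 + 2 * D 0 i2 * S 0 i2 + 2 * D 0 i3 * P 0 i1
    + 2 * D 0 i3 * Q 0 i2 + 4 * D 0 i3 * S 0 i3
    + 2 * (r0 + D 0 i3 * (s0 * D 0 i1 + t0 * D 0 i2 + r0 * D 0 i3)) = 0 ->
  torsion_components D P Q S s t r T ->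
  torsion_components D P Q S s0 t0 r0 T' ->
  torsion_sqnorm T <= torsion_sqnorm T' -> [/\ s = s0, t = t0 & r = r0].
Proof.
rewrite dotE; set n := (X in X = 1); set G1 := (X in X = 0) => DD g1.
set G2 := (X in X = 0) => g2; set G3 := (X in X = 0) => g3.
move=> /torsion_components_sqnorm -> /torsion_components_sqnorm ->.
rewrite -subr_ge0; set N := (X in 0 <= X).
pose q := (s - s0) ^+ 2 + (t - t0) ^+ 2 + (r - r0) ^+ 2.
pose q' := ((s - s0) * D 0 i1 + (t - t0) * D 0 i2 + (r - r0) * D 0 i3) ^+ 2.
(* Exact Taylor expansion at (s0, t0, r0). The gradient [G1], [G2], [G3] is written for |D| = 1; the
   term with [n - 1] corrects this, so that the identity is polynomial. *)
have -> : N = - q - q' - ((s - s0) * G1 + (t - t0) * G2 + (r - r0) * G3) -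
    (n - 1) * (q + 2 * ((s - s0) * s0 + (t - t0) * t0 + (r - r0) * r0)).
  by rewrite /N /G1 /G2 /G3 /n /q /q'; ring.
rewrite g1 g2 g3 DD => N0.
have q'_ge0 : 0 <= q' by exact: sqr_ge0.
have s_ge0 := sqr_ge0 (s - s0); have t_ge0 := sqr_ge0 (t - t0).
have r_ge0 := sqr_ge0 (r - r0).
(* What is left is 0 <= - q - q' with [q] and [q'] nonnegative, so [q] vanishes and the minimizer is
   unique. *)
have [s2' t2' r2'] : [/\ (s - s0) ^+ 2 = 0, (t - t0) ^+ 2 = 0 & (r - r0) ^+ 2 = 0].
  by move: N0; rewrite /q => N0; split; lra.
by split; apply/eqP; rewrite -subr_eq0 -sqrf_eq0 ?s2' ?t2' ?r2'.
Qed.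

(* Sherman-Morrison: for [|D| = 1] the inverse of [2 (I + D D^T)] is
   [(2 I - D D^T) / 4]. *)
Lemma stationary_parameters (x y z a b c : R) (n := x * x + y * y + z * z) :
  n = 1 ->
  let s := (- 2 * a * (x ^+ 2 + 2 * y ^+ 2 + 2 * z ^+ 2)
            + b * (2 * x * y) + c * (2 * x * z)) / 8 in
  let t := (a * (2 * x * y) - 2 * b * (2 * x ^+ 2 + y ^+ 2 + 2 * z ^+ 2)
            + c * (2 * y * z)) / 8 in
  let r := (a * (2 * x * z) + b * (2 * y * z)
            - 2 * c * (2 * x ^+ 2 + 2 * y ^+ 2 + z ^+ 2)) / 8 in
  [/\ a + 2 * (s + x * (s * x + t * y + r * z)) = 0,
      b + 2 * (t + y * (s * x + t * y + r * z)) = 0 &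
      c + 2 * (r + z * (s * x + t * y + r * z)) = 0].
Proof.
move=> n1 s t r.
(* Without n = 1 each left side equals (1 - n) (w (1 + n) + 2 q), where w is the coefficient a, b or
   c and q the matching parameter. *)
have defect w q : n = 1 -> (1 - n) * (w * (1 + n) + 2 * q) = 0.
  by move=> ->; rewrite subrr mul0r.
split; [rewrite -(defect a s n1)|rewrite -(defect b t n1)|
  rewrite -(defect c r n1)]; rewrite /s /t /r /n; by field.
Qed.

End Torsion.

(** * The compatibility equations in vector form *)

Section Compatibility.
Context {R : realType} {M : manifold R 3}.
Variables (F : finsler M) (gamma : riemannian M) (p : M) (u : chart R 3 M).
Hypothesis hu : chart_at p u.

Lemma derivable_gradF (c : R -> 'rV[R]_3) (t : R) : c t != 0 ->
  derivable c t (1 : R) -> derivable (gradF F p u \o c) t (1 : R).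
Proof.
move=> ct0 /derivable1_diffP cP; apply/derivable_mxP => i j.
under eq_fun do rewrite /= mxE.
apply/derivable1_diffP.
apply: (@differentiable_comp _ _ _ _ (fun s => (cmap u p, c s))).
  exact: differentiable_pair.
(* The components of G are first derivatives of F, so smoothness of order two off the zero section
   makes them differentiable. *)
have [_ /(_ (0, basis_vec R j))[dP _]] := finsler_smooth F hu.1 2%N.
apply: dP; split=> //=; by exists p => //; exact: hu.2.
Qed.

Lemma derivable_CxG (c : R -> 'rV[R]_3) (t : R) : c t != 0 ->
  derivable c t (1 : R) -> derivable (CxG F p u \o c) t (1 : R).
Proof. by move=> ct0 cP; exact: derivable_cross cP (derivable_gradF _ _ ct0 cP). Qed.

Lemma orthonormal_metric_mx : orthonormal_at gamma p u ->
  metric_mx gamma u (cmap u p) = 1%:M.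
Proof.
by move=> ho; apply/matrixP => i j; rewrite !mxE chart_mapK ?ho //; exact: hu.2.
Qed.

Lemma compatibility_eqsP T : orthonormal_at gamma p u -> antisym T ->
  compatibility_eqs F gamma p u T <-> forall y, y != 0 -> forall i,
    dot (contorsion_vec T i) (CxG F p u y) =
    - 2 * hderiv F gamma u i (cmap u p, y).
Proof.
move=> ho Ta; rewrite /compatibility_eqs /metric_inv orthonormal_metric_mx // invmx1.
suff E (y : 'rV[R]_3) i : \sum_(j < 3) \sum_(r < 3) y 0 j *
      (\sum_(k < 3) \sum_(l < 3) (T j k l * (1%:M : 'M[R]_3) k r * (1%:M : 'M[R]_3) i l +
           T i k l * (1%:M : 'M[R]_3) k r * (1%:M : 'M[R]_3) j l) - T i j r) *
      dfib r (local_fun F u) (cmap u p, y) = dot (contorsion_vec T i) (CxG F p u y).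
  by split=> H y y0 i; rewrite -(H y y0 i) E.
rewrite -contorsion_vecP //; apply: eq_bigr => j _; apply: eq_bigr => r _.
rewrite [gradF _ _ _ _ _ _]mxE; congr (_ * (_ - _) * _).
(* With gamma the identity only k = r survives, together with l = i in the first term and l = j in
   the second. *)
rewrite (bigD1 r) //= [X in _ + X]big1 => [|k /negbTE kr]; last first.
  by apply: big1 => l _; rewrite !mxE kr !mulr0 !mul0r addr0.
rewrite addr0 big_split /= (bigD1 i) //= big1 => [|l /negbTE il]; last first.
  by rewrite !mxE (eq_sym i) il mulr0.
rewrite (bigD1 j) //= big1 => [|l /negbTE il]; last first.
  by rewrite !mxE (eq_sym j) il mulr0.
by rewrite !mxE !eqxx !mulr1 !addr0.
Qed.

(** * Solutions expanded in the Frenet frame of the integral curve *)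

Section IntegralCurve.
Variables (v : 'rV[R]_3) (eps : R) (c0 : R -> 'rV[R]_3).
Hypotheses (eps_gt0 : 0 < eps) (hc0 : integral_curve F p u v eps c0).

Let W := CxG F p u.

Lemma integral_curve_near : \forall t \near (0 : R),
  [/\ c0 t != 0, W (c0 t) != 0, derivable c0 t (1 : R) &
      frenet_T c0 t = (enorm (W (c0 t)))^-1 *: W (c0 t)].
Proof.
apply: (near_itv0 eps) => // t /hc0.2[ct0 nvc cP]; split=> //.
- by apply/eqP => W0; apply: nvc.
- by rewrite /frenet_T derive1E; case: cP.
Qed.

Lemma integral_curve_deriv : \forall t \near (0 : R), derivable c0 t (1 : R).
Proof. by apply: filterS integral_curve_near => t []. Qed.

Lemma integral_curve_unit :
  \forall t \near (0 : R), dot (frenet_T c0 t) (frenet_T c0 t) = 1.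
Proof.
by apply: filterS integral_curve_near => t [_ W0 _ ->]; exact: dot_normalize.
Qed.

(** C x G is orthogonal to the position C, so the curve stays on a sphere about the origin. *)
Lemma integral_curve_sphere :
  \forall t \near (0 : R), dot (c0 t) (frenet_T c0 t) = 0.
Proof.
by apply: filterS integral_curve_near => t [_ _ _ ->];
  rewrite dotZr dot_cross_l mulr0.
Qed.

(** The second derivative of [c0] comes from its differential equation: near 0 the tangent is the
    normalized field along [c0], which is again derivable. *)
Lemma integral_curve_T_deriv : derivable (frenet_T c0) 0 (1 : R).
Proof.
have [c00 W0 cP _] := nbhs_singleton integral_curve_near.
apply: (@near_eq_derivable _ _ _ (fun t => (enorm (W (c0 t)))^-1 *: W (c0 t))).
  by apply: filterS integral_curve_near => t [_ _ _ ->].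
exact: (derivable_normalize (W \o c0) 0 W0 (derivable_CxG c0 0 c00 cP)).
Qed.

Let D := frenet_B c0 0.

Lemma integral_curve_BB : dot D D = 1.
Proof.
exact: frenet_BB integral_curve_deriv integral_curve_unit integral_curve_sphere
  integral_curve_T_deriv.
Qed.

Lemma integral_curve_expand a (b : R -> R) :
  (\forall t \near (0 : R), dot a (frenet_T c0 t) = b t) ->
  a = b 0 *: frenet_T c0 0 +
      (derive1 b 0 / curvature c0 0) *: frenet_N c0 0 + dot a D *: D.
Proof.
exact: frenet_expand integral_curve_deriv integral_curve_unit
  integral_curve_sphere integral_curve_T_deriv a b.
Qed.

(** The vector [z] is orthogonal to the tangent near 0, so its T and N parts vanish and it is a
    nonzero multiple of [D]. *)
Lemma frenet_B_annihilates z : z != 0 ->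
  (forall w, w != 0 -> dot (W w) z = 0) -> forall w, w != 0 -> dot (W w) D = 0.
Proof.
move=> z0 Wz w w0.
have zT : \forall t \near (0 : R), dot z (frenet_T c0 t) = cst 0 t.
  by apply: filterS integral_curve_near => t [ct0 _ _ ->];
    rewrite dotZr dotC Wz ?mulr0.
have zE := integral_curve_expand _ _ zT.
rewrite derive1_cst mul0r !scale0r !add0r in zE.
have := Wz w w0; rewrite {1}zE dotZr => /eqP; rewrite mulf_eq0 => /orP[|/eqP//].
by move=> /eqP zD; move: z0; rewrite zE zD scale0r eqxx.
Qed.

(** Dividing the equation by |C x G| along [c0] gives <a, T> = b_i^0; the factor 2 undoes the one
    half in [PQR]. *)
Lemma horizontal_solution_expand i a :
  (forall w, w != 0 -> dot a (W w) = - 2 * hderiv F gamma u i (cmap u p, w)) ->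
  a = 2 *: PQR F gamma p u c0 i + dot a D *: D.
Proof.
move=> aE; rewrite /PQR scalerA divff ?pnatr_eq0 // scale1r.
apply: (integral_curve_expand _ (b0 F gamma p u i \o c0)).
apply: filterS integral_curve_near => t [ct0 _ _ ->].
by rewrite dotZr aE // mulrC.
Qed.

Lemma compatibility_eqs_solutions T0 z : orthonormal_at gamma p u ->
  compatible_torsion F gamma p u T0 -> z != 0 ->
  (forall w, w != 0 -> dot (W w) z = 0) ->
  forall T, antisym T ->
    (compatibility_eqs F gamma p u T <->
     exists s t r, torsion_components D (PQR F gamma p u c0 i1)
       (PQR F gamma p u c0 i2) (PQR F gamma p u c0 i3) s t r T).
Proof.
move=> ho [T0a /(compatibility_eqsP _ ho T0a) T0E] z0 Wz T Ta.
have WD := frenet_B_annihilates z z0 Wz.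
rewrite compatibility_eqsP //; split=> [TE|[s [t [r /torsion_componentsP]]]].
  (* Halved because the parameters enter [torsion_componentsP] doubled. *)
  pose a i := dot (contorsion_vec T i) D / 2.
  exists (a i1), (a i2), (a i3); apply/torsion_componentsP => //.
  have aE i : contorsion_vec T i = 2 *: PQR F gamma p u c0 i + (2 * a i) *: D.
    rewrite /a [2 * _]mulrC divfK ?pnatr_eq0 //.
    by apply: horizontal_solution_expand => w w0; exact: TE.
  by split.
move=> /(_ Ta)[e1 e2 e3] w w0 i.
(* The vectors of [T] and of the known solution [T0] share their T and N parts; they differ along
   [D], which is orthogonal to all C x G. *)
have [k ->] : exists k, contorsion_vec T i = contorsion_vec T0 i + k *: D.
  have T0i := horizontal_solution_expand i _ (fun w w0 => T0E w w0 i).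
  have [k ->] : exists k, contorsion_vec T i = 2 *: PQR F gamma p u c0 i + k *: D.
    by have [->|->|->] := ord3P i; eexists; eassumption.
  exists (k - dot (contorsion_vec T0 i) D).
  by rewrite {1}T0i -addrA -scalerDl [_ + (k - _)]addrC subrK.
by rewrite dotDl dotZl (dotC D) WD // mulr0 addr0; exact: T0E.
Qed.

End IntegralCurve.
End Compatibility.

(** * Identification of the extremal parameters *)

Theorem theorem4 (R : realType) (M : manifold R 3) (F : finsler M)
    (gamma : riemannian M) (nabla : connection M) (p : M) (u : chart R 3 M)
    (v : 'rV[R]_3) (eps : R) (c0 : R -> 'rV[R]_3)
    (hconn : connected [set: M])
    (hnonRiem : ~ is_riemannian F)
    (hBerwald : generalized_Berwald F)
    (hgamma : compatible_metric F gamma)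
    (hextremal : extremal_compatible F gamma nabla)
    (hu : chart_at p u)
    (hortho : orthonormal_at gamma p u)
    (hundet : exists2 L : {vspace 'rV[R]_3}, \dim L = 1%N &
       forall t : 'rV[R]_3,
         t \in L <-> forall w : 'rV[R]_3, w != 0 -> dot (CxG F p u w) t = 0)
    (hv : v != 0)
    (hvc : ~ vertical_contact F p u v)
    (heps : 0 < eps)
    (hc0 : integral_curve F p u v eps c0) :
  let D := frenet_B c0 0 in
  let P := PQR F gamma p u c0 i1 in
  let Q := PQR F gamma p u c0 i2 in
  let S := PQR F gamma p u c0 i3 in
  let D1 := D 0 i1 in let D2 := D 0 i2 in let D3 := D 0 i3 in
  let P1 := P 0 i1 in let P2 := P 0 i2 in let P3 := P 0 i3 in
  let Q1 := Q 0 i1 in let Q2 := Q 0 i2 in let Q3 := Q 0 i3 in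
  let R1 := S 0 i1 in let R2 := S 0 i2 in let R3 := S 0 i3 in
  let d := 4 * D1 * P1 + 2 * D1 * Q2 + 2 * D1 * R3 + 2 * D2 * P2
           + 2 * D3 * P3 in
  let e := 2 * D1 * Q1 + 2 * D2 * P1 + 4 * D2 * Q2 + 2 * D2 * R3
           + 2 * D3 * Q3 in
  let f := 2 * D1 * R1 + 2 * D2 * R2 + 2 * D3 * P1 + 2 * D3 * Q2
           + 4 * D3 * R3 in
  let g := 2 * D1 * D2 in
  let h := 2 * D1 * D3 in
  let i := 2 * D2 * D3 in
  let k := D1 ^+ 2 + 2 * D2 ^+ 2 + 2 * D3 ^+ 2 in
  let l := 2 * D1 ^+ 2 + D2 ^+ 2 + 2 * D3 ^+ 2 in
  let m := 2 * D1 ^+ 2 + 2 * D2 ^+ 2 + D3 ^+ 2 in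
  let s0 := (- 2 * d * k + e * g + f * h) / (8 * enorm D ^+ 4) in
  let t0 := (d * g - 2 * e * l + f * i) / (8 * enorm D ^+ 4) in
  let u0 := (d * h + e * i - 2 * f * m) / (8 * enorm D ^+ 4) in
  (forall T : 'I_3 -> 'I_3 -> 'I_3 -> R, antisym T ->
     (compatibility_eqs F gamma p u T <->
      exists s t r, torsion_components D P Q S s t r T)) /\
  torsion_components D P Q S s0 t0 u0 (torsion nabla u (cmap u p)).
Proof.
move=> D P Q S D1 D2 D3 P1 P2 P3 Q1 Q2 Q3 R1 R2 R3 d e f g h i k l m s0 t0 u0.
have [T0c T0min] := hextremal.2 p u hu hortho.
have [z z0 Wz] :
    exists2 z : 'rV[R]_3, z != 0 & forall w, w != 0 -> dot (CxG F p u w) z = 0.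
  have [L L1 LE] := hundet; exists (vpick L); last exact/LE/memv_pick.
  by rewrite vpick0 -dimv_eq0 L1.
have sol := compatibility_eqs_solutions F gamma p u hu v eps c0 heps hc0 _ z
  hortho T0c z0 Wz.
split=> //; have /(sol _ T0c.1)[s [t [r sT0]]] := T0c.2.
have DD : dot D D = 1 := integral_curve_BB F p u hu v eps c0 heps hc0.
(* The competitor: a solution with the claimed parameters, whose norm is at least that of the
   extremal torsion. *)
have [T Ta sT] := torsion_components_exists D P Q S s0 t0 u0.
have TE : compatibility_eqs F gamma p u T by apply/(sol _ Ta); exists s0, t0, u0.
(* The binormal is a unit vector, so the denominators reduce to 8. *)
have D4 : enorm D ^+ 4 = 1 by rewrite -[4%N]/(2 * 2)%N exprM enorm_sqr DD expr1n.
have [grad_s grad_t grad_u] :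
    [/\ d + 2 * (s0 + D1 * (s0 * D1 + t0 * D2 + u0 * D3)) = 0,
        e + 2 * (t0 + D2 * (s0 * D1 + t0 * D2 + u0 * D3)) = 0 &
        f + 2 * (u0 + D3 * (s0 * D1 + t0 * D2 + u0 * D3)) = 0].
  rewrite /s0 /t0 /u0 D4 mulr1; apply: stationary_parameters.
  by rewrite -[RHS]DD dotE.
have [ss tt rr] := torsion_components_minimal _ _ _ _ _ _ _ _ _ _ _ _ DD
  grad_s grad_t grad_u sT0 sT (T0min T (conj Ta TE)).
by move: sT0; rewrite ss tt rr.
Qed.
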